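(* Let $\pi$ be a matching of size $n$ with associated sequence $a_1<\dots<a_n$, and for an integer $p$ let $D_\pi(p)=\det_{1\le i,j\le n}\left[\binom{p+i-1}{a_i-j}\right]$. Then: (i) if $p\ge0$, $D_\pi(p)$ equals the number of fillings of $Y(\pi)$ with integers in $\{1,\dots,p+n-1\}$ that are strictly increasing along rows (left to right) and along columns (top to bottom); in particular $D_\pi(p)>0$; (ii) if $p\le-n$, $(-1)^{d(\pi)}D_\pi(p)$ equals the number of fillings of $Y(\pi)$ with integers in $\{0,1,\dots,|p|-n\}$ that are weakly increasing along rows and along columns; in particular $D_\pi(p)\neq0$, and $D_\pi(-n)=(-1)^{d(\pi)}$; (iii) if $1-n\le p\le -1$ and $\pi$ is not of the form $(\rho)_{|p|}$ for a matching $\rho$, then $D_\pi(p)=0$.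
   Context: A matching of size $n$ is a set of $n$ disjoint noncrossing pairs (arches) partitioning $\{1,\dots,2n\}$; $a_1<\dots<a_n$ are the smaller elements of its arches. The Young diagram $Y(\pi)$ has rows, from top to bottom, of lengths $a_n-n\ge\dots\ge a_1-1$; $d(\pi)=\sum_i(a_i-i)$ is its number of boxes. $(\rho)_q$ denotes the matching $\rho$ (of size $m$) surrounded by $q$ nested arches: arches $\{i,2m+2q+1-i\}$ for $1\le i\le q$ and $\{q+i,q+j\}$ for $\{i,j\}\in\rho$ (here $\rho$ may be the empty matching). Binomial coefficients are generalized: for an integer $x$ and integer $k$, $\binom{x}{k}=x(x-1)\cdots(x-k+1)/k!$ if $k\ge0$ and $\binom{x}{k}=0$ if $k<0$. *)

(* Defs.v *)
From HB Require Import structures.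
From mathcomp Require Import all_boot all_order all_algebra.
Set Implicit Arguments. Unset Strict Implicit. Unset Printing Implicit Defensive.
Import Order.TTheory GRing.Theory Num.Theory.

(* A matching of size n: a list of arches (x.1, x.2) with x.1 < x.2,
   whose endpoints form exactly {1,...,2n} (so arches are disjoint and
   partition {1..2n}), and which are pairwise noncrossing. *)
Definition is_matching (n : nat) (m : seq (nat * nat)) : Prop :=
  [/\ all (fun x => x.1 < x.2) m,
      perm_eq (flatten [seq [:: x.1; x.2] | x <- m]) (iota 1 (2 * n)) &
      {in m &, forall x y, ~~ [&& x.1 < y.1, y.1 < x.2 & x.2 < y.2]}].

(* the increasing sequence a_1 < ... < a_n of smaller endpoints;
   a_i (1-based) is  avec m i  *)
Definition aseq (m : seq (nat * nat)) : seq nat := sort leq (map fst m).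
Definition avec (m : seq (nat * nat)) (i : nat) : nat := nth 0 (aseq m) i.-1.

(* Young diagram Y(pi): row lengths from top to bottom a_n - n >= ... >= a_1 - 1 *)
Definition yshape (n : nat) (m : seq (nat * nat)) : seq nat :=
  rev [seq avec m i - i | i <- iota 1 n].

Definition dpi (n : nat) (m : seq (nat * nat)) : nat :=
  \sum_(1 <= i < n.+1) (avec m i - i).

Definition nest (q : nat) (rho : seq (nat * nat)) : seq (nat * nat) :=
  [seq (i, 2 * size rho + 2 * q + 1 - i) | i <- iota 1 q]
  ++ [seq (q + x.1, q + x.2) | x <- rho].

Definition gbinom (x k : int) : int :=
  match k with
  | Posz k' => ((\prod_(t < k') (x - t%:Z)) %/ (k'`!)%:Z)%Z
  | Negz _ => 0
  end.

(* D_pi(p) = det [ binom(p+i-1, a_i - j) ]_{1<=i,j<=n} (0-based indices below) *)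
Definition Dpi (n : nat) (m : seq (nat * nat)) (p : int) : int :=
  \det (\matrix_(i < n, j < n)
          gbinom (p + (i : nat)%:Z) ((avec m i.+1)%:Z - (j.+1 : nat)%:Z)).

(* cells of a Young diagram with row lengths lam (top to bottom), 0-based
   (row, column) coordinates *)
Definition cell (lam : seq nat) : Type :=
  {x : 'I_(size lam) * 'I_(sumn lam) | x.2 < nth 0 lam x.1}.

Definition right_adj (lam : seq nat) (x y : cell lam) : bool :=
  ((val x).1 == (val y).1 :> nat) && ((val y).2 == (val x).2 .+1 :> nat).
Definition below_adj (lam : seq nat) (x y : cell lam) : bool :=
  ((val y).1 == (val x).1 .+1 :> nat) && ((val x).2 == (val y).2 :> nat).

Definition strict_fillings (lam : seq nat) (N : nat) :=
  [set f : {ffun cell lam -> 'I_N} |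
     [forall x, 1 <= (f x : nat)] &&
     [forall x, forall y,
        (right_adj x y || below_adj x y) ==> ((f x : nat) < f y)]].

Definition weak_fillings (lam : seq nat) (K : nat) :=
  [set f : {ffun cell lam -> 'I_K.+1} |
     [forall x, forall y,
        (right_adj x y || below_adj x y) ==> ((f x : nat) <= f y)]].

(* Main.v *)
(* Write l for the row lengths a_i - i. Pascal's rule in each row of the matrix,
   followed by the subtraction of row i-1 from row i, gives for every integer p
     D_l(p) = sum over sets S of corners of l of D_(l minus S)(p-1),
   while D_l(1-n) is 1 for the empty diagram and 0 otherwise. Removing the cells
   with the largest entry shows that the strict fillings with values in
   {1,...,p+n-1} obey the same recursion in p, and inclusion-exclusion over the
   corners with the largest entry shows that, up to the sign (-1)^d, the weak
   fillings with |p|-n+1 values obey it read backwards from p = 1-n. Hence the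
   strict count is valid for all p >= 1-n; when it is nonzero at p = -q, the
   strict chains force a_i <= 2i-1-q for i > q, which says that the Dyck path of
   pi stays at height at least q in its middle, i.e. that pi has q outer arches. *)
Require Import Defs.
From HB Require Import structures.
From mathcomp Require Import all_boot all_order all_algebra.
From mathcomp Require Import zify ring.
Import Order.TTheory GRing.Theory Num.Theory.
Local Open Scope ring_scope.

(** * Generalized binomials *)

(** The integer division in [gbinom] is exact: for x >= 0 the product is a falling factorial, and
    for x < 0 reversing its factors turns it, up to sign, into the falling factorial of a natural
    number. *)
Lemma gbinom_mul_fact (x : int) (k : nat) :
  gbinom x k * k`!%:Z = \prod_(t < k) (x - t%:Z).
Proof.
rewrite /gbinom divzK //.
have ffactE (y k' : nat) : \prod_(t < k') (y%:Z - t%:Z) = (y ^_ k')%:Z.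
  elim: k' => [|k' IHk]; first by rewrite big_ord0.
  rewrite big_ord_recr /= IHk ffactnSr PoszM.
  have [le_ky | lt_yk] := leqP k' y; first by rewrite subzn.
  by rewrite ffact_small // !mul0r.
have fact_dvd (y k' : nat) : (k'`!%:Z %| (y ^_ k')%:Z)%Z.
  by rewrite -bin_ffact PoszM dvdz_mull.
case: x => [y|y]; first by rewrite ffactE.
have -> : \prod_(t < k) (Negz y - t%:Z)
    = (-1) ^+ k * \prod_(t < k) ((y + k)%N%:Z - t%:Z).
  rewrite [in RHS](reindex_inj rev_ord_inj) -[k in (-1) ^+ k]card_ord.
  rewrite -prodr_const -big_split /=; apply: eq_bigr => t _.
  by have := ltn_ord t; rewrite NegzE; lia.
by rewrite ffactE dvdz_mull.
Qed.

Lemma gbinom_small (n k : nat) : (n < k)%N -> gbinom n k = 0.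
Proof.
move=> lt_nk; have: gbinom n k * k`!%:Z = 0.
  by rewrite gbinom_mul_fact (bigD1 (Ordinal lt_nk)) //= subrr mul0r.
by move/eqP; rewrite mulf_eq0 eqz_nat -leqn0 leqNgt fact_gt0 orbF => /eqP.
Qed.

Lemma gbinomx0 (x : int) : gbinom x 0 = 1.
Proof. by rewrite /gbinom /= big_ord0. Qed.

Lemma gbinom_neg (x k : int) : k < 0 -> gbinom x k = 0.
Proof. by case: k. Qed.

(** For a lower index k+1 > 0, multiplication by (k+1)! leaves the common factor (x-1)...(x-k) and
    the identity x = (x-1-k) + (k+1). *)
Lemma gbinom_pascal (x k : int) :
  gbinom x k = gbinom (x - 1) k + gbinom (x - 1) (k - 1).
Proof.
case: k => [[|k]|k]; last 1 first.
- by rewrite !gbinom_neg; lia.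
- by rewrite !gbinomx0 gbinom_neg.
have -> : Posz k.+1 - 1 = k by lia.
have fact_neq0 : k.+1`!%:Z != 0 by rewrite eqz_nat -lt0n fact_gt0.
apply: (mulIf fact_neq0); rewrite mulrDl !gbinom_mul_fact factS PoszM.
rewrite mulrCA gbinom_mul_fact big_ord_recl big_ord_recr /=.
have shiftE (i : 'I_k) : x - (bump 0 i)%:Z = x - 1 - i%:Z.
  by rewrite /bump; lia.
under eq_bigr => i _ do rewrite shiftE.
by ring.
Qed.

(** * Strict and weak fillings of a finite relation *)

Lemma card_can_eq (T1 T2 : finType) (A : {set T1}) (B : {set T2})
    (f : T1 -> T2) (g : T2 -> T1) :
  {in A, forall x, f x \in B} -> {in B, forall y, g y \in A} ->
  {in A, cancel f g} -> {in B, cancel g f} -> #|A| = #|B|.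
Proof.
move=> fA gB fK gK; apply/eqP; rewrite eqn_leq; apply/andP; split.
- rewrite -(card_in_imset (can_in_inj fK)); apply/subset_leq_card/subsetP.
  by move=> _ /imsetP[x Ax ->]; apply: fA.
- rewrite -(card_in_imset (can_in_inj gK)); apply/subset_leq_card/subsetP.
  by move=> _ /imsetP[y By ->]; apply: gB.
Qed.

(** Expand the product over x of 1 - [x in X], which vanishes as soon as X has an element. *)
Lemma sum_sign_subset (T : finType) (X : {set T}) :
  \sum_(S : {set T} | S \subset X) (-1) ^+ #|S| = (X == set0)%:R :> int.
Proof.
transitivity (\prod_x (- (x \in X)%:R + 1 : int)); last first.
  have [->|/set0Pn[x Xx]] := eqVneq X set0.
    by rewrite big1 // => x _; rewrite inE oppr0 add0r.
  by rewrite (bigD1 x) //= Xx addNr mul0r.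
rewrite bigA_distr [LHS]big_mkcond; apply: eq_bigr => S _ /=.
rewrite -big_mkcond /=; case: ifP => [/subsetP sSX | /negbT/subsetPn[x Sx Xx]].
  by rewrite -prodr_const; apply: eq_bigr => x /sSX ->.
by rewrite (bigD1 x) //= (negPf Xx) oppr0 mul0r.
Qed.

Section Fillings.
Variables (T : finType) (e : rel T) (M : nat).
Implicit Types (r : rel nat) (A S : {set T}) (f : {ffun T -> 'I_M.+1}).

(* Fillings of A with values in {1,...,k}, extended by 0 outside A. *)
Definition fillings r A (k : nat) :=
  [set f : {ffun T -> 'I_M.+1} |
    [&& [forall x, (x \in A) == (0 < f x)%N], [forall x, (f x <= k)%N] &
        [forall x in A, forall y in A, e x y ==> r (f x) (f y)]]].

Lemma fillingsP r A k f :
  reflect [/\ forall x, (x \in A) = (0 < f x)%N, forall x, (f x <= k)%N &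
              {in A &, forall x y, e x y -> r (f x) (f y)}]
          (f \in fillings r A k).
Proof.
rewrite inE; apply: (iffP and3P) => -[fA fk fr]; split.
- by move=> x; apply/eqP/(forallP fA).
- exact/forallP.
- by move=> x y Ax Ay; apply/implyP; move/forall_inP: fr => /(_ x Ax)/forall_inP->.
- by apply/forallP => x; apply/eqP.
- exact/forallP.
- by apply/forall_inP => x Ax; apply/forall_inP => y Ay; apply/implyP/fr.
Qed.

(** For diagrams these turn out to be the corner cells, which can be removed. *)
Definition maxels A := [set x in A | [forall y in A, ~~ e x y]].

Lemma maxelsP A x :
  reflect (x \in A /\ {in A, forall y, ~~ e x y}) (x \in maxels A).
Proof. by rewrite inE; apply: (iffP andP) => -[Ax /forall_inP]. Qed.

Definition top f (k : nat) := [set x | f x == k :> nat].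

Definition erase S f : {ffun T -> 'I_M.+1} :=
  [ffun x => if x \in S then ord0 else f x].

Definition raise S (k : nat) f : {ffun T -> 'I_M.+1} :=
  [ffun x => if x \in S then inord k else f x].

Lemma raiseK S k f : {in S, forall x, f x = ord0} -> erase S (raise S k f) = f.
Proof.
move=> f0; apply/ffunP => x; rewrite !ffunE; case Sx: (x \in S) => //.
by rewrite f0.
Qed.

Lemma eraseK S k f : (k <= M)%N -> S \subset top f k -> raise S k (erase S f) = f.
Proof.
move=> le_kM /subsetP topS; apply/ffunP => x; rewrite !ffunE.
case: (boolP (x \in S)) => // /topS; rewrite inE => /eqP fx.
by apply: val_inj; rewrite /= fx inordK.
Qed.

Lemma erase_fillings r A S k f :
  f \in fillings r A k -> erase S f \in fillings r (A :\: S) k.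
Proof.
case/fillingsP => fA fk fr; apply/fillingsP; split.
- by move=> x; rewrite inE ffunE fA; case: ifP.
- by move=> x; rewrite ffunE; case: ifP.
- move=> x y; rewrite !inE !ffunE => /andP[/negPf-> Ax] /andP[/negPf-> Ay].
  exact: fr.
Qed.

Lemma raise_fillings r A S k f : (k < M)%N ->
    S \subset maxels A -> f \in fillings r (A :\: S) k.+1 ->
    {in A :\: S, forall x, r (f x) k.+1} ->
  raise S k.+1 f \in fillings r A k.+1.
Proof.
move=> lt_kM /subsetP maxS /fillingsP[fA fk fr] frk; apply/fillingsP; split.
- move=> x; rewrite ffunE; case: ifP => [/maxS/maxelsP[-> _]|Sx].
    by rewrite inordK.
  by rewrite -fA inE Sx.
- by move=> x; rewrite ffunE; case: ifP => // _; rewrite inordK.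
- move=> x y Ax Ay exy; rewrite !ffunE.
  case: ifP => [/maxS/maxelsP[_ /(_ y Ay)]|Sx]; first by rewrite exy.
  have ASx : x \in A :\: S by rewrite inE Sx.
  case: ifP => [_|Sy]; first by rewrite inordK //; apply: frk.
  by apply: fr; rewrite // inE Sy.
Qed.

Lemma fillings_setD0 r A S k f :
  f \in fillings r (A :\: S) k -> {in S, forall x, f x = ord0}.
Proof.
case/fillingsP => fA _ _ x Sx; apply/val_inj/eqP; rewrite /= -leqn0 leqNgt -fA.
by rewrite inE Sx.
Qed.

Lemma fillings_leq r A k k' f :
  (k <= k')%N -> f \in fillings r A k -> f \in fillings r A k'.
Proof.
move=> le_kk' /fillingsP[fA fk fr]; apply/fillingsP; split => // x.
exact: leq_trans (fk x) le_kk'.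
Qed.

(** In a strict filling the cells carrying k+1 form a set S of maximal cells. Erasing them leaves an
    arbitrary strict filling of the rest with values up to k, and [raise] inverts this. *)
Lemma card_strict_fillings_rec A k : (k < M)%N ->
  #|fillings ltn A k.+1| =
  (\sum_(S : {set T} | S \subset maxels A) #|fillings ltn (A :\: S) k|)%N.
Proof.
move=> lt_kM; rewrite -sum1_card.
rewrite (partition_big (fun f => top f k.+1) (fun S => S \subset maxels A)).
  move=> /=; apply: eq_bigr => S maxS; rewrite sum1dep_card.
  apply: (@card_can_eq _ _ _ _ (erase S) (raise S k.+1)) => f.
  - rewrite inE => /andP[Af /eqP topf].
    have /fillingsP[fA fk fr] := erase_fillings _ _ S _ _ Af.
    apply/fillingsP; split => // x; rewrite -ltnS ltn_neqAle fk andbT ffunE.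
    by case: ifPn => //; rewrite -topf inE.
  - move=> Af; have /fillingsP[fA fk fr] := Af.
    have leSf := fillings_leq _ _ _ _ _ (leqnSn k) Af.
    rewrite inE raise_fillings //=; last by move=> x _; rewrite /= ltnS.
    apply/eqP/setP => x; rewrite inE ffunE; case: ifP => _.
      by rewrite inordK // eqxx.
    by rewrite ltn_eqF // ltnS.
  - by rewrite inE => /andP[_ /eqP topf]; rewrite eraseK // topf.
  - by move=> Af; apply/raiseK/(fillings_setD0 _ _ _ _ _ Af).
move=> f /fillingsP[fA fk fr]; apply/subsetP => x; rewrite inE => /eqP fx.
apply/maxelsP; rewrite fA fx; split => // y Ay; apply/negP => exy.
have Ax : x \in A by rewrite fA fx.
by have := fr x y Ax Ay exy; rewrite /= fx ltnNge fk.
Qed.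

(** Raising maximal cells to k+1 never breaks weak monotonicity, so prescribing k+1 on S puts no
    constraint on the other entries. *)
Lemma card_weak_fillings_top A S k : (k < M)%N -> S \subset maxels A ->
  #|[set f in fillings leq A k.+1 | S \subset top f k.+1]| =
  #|fillings leq (A :\: S) k.+1|.
Proof.
move=> lt_kM maxS.
apply: (@card_can_eq _ _ _ _ (erase S) (raise S k.+1)) => f.
- by rewrite inE => /andP[Af _]; apply: erase_fillings.
- move=> Af; have /fillingsP[fA fk fr] := Af.
  rewrite inE raise_fillings //=.
  by apply/subsetP => x Sx; rewrite inE ffunE Sx inordK.
- by rewrite inE => /andP[_ topf]; rewrite eraseK.
- by move=> Af; apply/raiseK/(fillings_setD0 _ _ _ _ _ Af).
Qed.

(** If k+1 occurs, a cell of greatest rank carrying it is maximal, since a successor in A would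
    carry k+1 too. *)
Lemma weak_fillings_top0 (rk : T -> nat) A k f :
    (forall x y, e x y -> (rk x < rk y)%N) -> f \in fillings leq A k.+1 ->
  (maxels A :&: top f k.+1 == set0) = (f \in fillings leq A k).
Proof.
move=> e_rk /fillingsP[fA fk fr]; apply/eqP/idP => [top0|/fillingsP[_ fk' _]].
  apply/fillingsP; split => // x; rewrite -ltnS ltn_neqAle fk andbT.
  apply/negP => fx; have: maxels A :&: top f k.+1 != set0; last by rewrite top0 eqxx.
  case: (arg_maxnP (P := fun y => f y == k.+1 :> nat) rk fx) => y /eqP fy rk_y.
  have Ay : y \in A by rewrite fA fy.
  apply/set0Pn; exists y; rewrite inE [y \in top _ _]inE fy eqxx andbT.
  apply/maxelsP; split => // z Az; apply/negP => eyz.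
  have fz : f z == k.+1 :> nat.
    by rewrite eqn_leq fk -fy; apply: fr.
  by have := rk_y _ fz; rewrite /= leqNgt e_rk.
apply/setP => x; rewrite !inE; apply/negP => /andP[_ /eqP fx].
by have := fk' x; rewrite fx ltnn.
Qed.

(* Inclusion-exclusion on the set of maximal cells carrying the value k+1. *)
Lemma card_weak_fillings_rec (rk : T -> nat) A k :
    (forall x y, e x y -> (rk x < rk y)%N) -> (k < M)%N ->
  #|fillings leq A k|%:Z =
  \sum_(S : {set T} | S \subset maxels A)
    (-1) ^+ #|S| * #|fillings leq (A :\: S) k.+1|%:Z.
Proof.
move=> e_rk lt_kM.
transitivity (\sum_(f in fillings leq A k.+1)
                (maxels A :&: top f k.+1 == set0)%:R : int).
  rewrite -sum1_card -natz natr_sum [LHS]big_mkcond [RHS]big_mkcond /=.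
  apply: eq_bigr => f _; case: (boolP (f \in fillings leq A k.+1)) => [Af|].
    by rewrite (weak_fillings_top0 rk) //; case: (f \in _).
  by case: ifP => // /(fillings_leq _ _ _ _ _ (leqnSn k)) ->.
under eq_bigr => f _ do rewrite -sum_sign_subset.
under [RHS]eq_bigr => S maxS.
  rewrite -card_weak_fillings_top // -sum1dep_card -natz natr_sum mulr_sumr.
  over.
rewrite (exchange_big_dep (fun S => S \subset maxels A)) /=; last first.
  by move=> f S _; rewrite subsetI => /andP[].
apply: eq_bigr => S maxS; apply: eq_big => [f|f _]; last by rewrite mulr1.
by rewrite subsetI maxS.
Qed.

Lemma card_fillings0 r A : #|fillings r A 0| = (A == set0).
Proof.
have [->|/set0Pn[x Ax]] := eqVneq A set0.
  rewrite (_ : fillings _ _ _ = [set [ffun=> ord0]]) ?cards1 //.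
  apply/setP => f; rewrite in_set1; apply/fillingsP/eqP => [[f0 _ _]|->].
    apply/ffunP => x; rewrite ffunE; apply/val_inj/eqP.
    by rewrite /= -leqn0 leqNgt -f0 inE.
  by split=> [x|x|x y]; rewrite ?ffunE ?inE.
apply/eqP; rewrite cards_eq0; apply/eqP/setP => f; rewrite in_set0.
apply/negbTE/negP => /fillingsP[fA fk _].
by have := fk x; rewrite leqNgt -fA Ax.
Qed.

End Fillings.

(** * The determinant of a shape *)

Section Shapes.
Variable n : nat.
Implicit Types (l : nat -> nat) (S : {set 'I_n}).

(* [l i] is the length a_(i+1) - (i+1) of the row of Y(pi) attached to
   a_(i+1): rows are numbered from bottom to top, starting at 0. *)
Definition is_shape l := forall i j : nat, (i <= j < n)%N -> (l i <= l j)%N.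

Definition shape_det l (p : int) : int :=
  \det (\matrix_(i < n, j < n)
          gbinom (p + (i : nat)%:Z) ((l i + i)%N%:Z - (j : nat)%:Z)).

(** The value 0 under the bottom row makes that row a corner exactly when it is nonempty. *)
Definition row_below l (i : nat) : nat := if i is i'.+1 then l i' else 0%N.

Definition corners l := [set i : 'I_n | (row_below l i < l i)%N].

(** The quantifier lets a function on [nat] use a set of ordinals; rows from index n on are left
    unchanged. *)
Definition remove_corners l S (i : nat) : nat :=
  (l i - [exists k in S, k == i :> nat])%N.

Lemma remove_cornersE l S (i : 'I_n) :
  remove_corners l S i = (l i - (i \in S))%N.
Proof.
rewrite /remove_corners; congr (_ - nat_of_bool _)%N.
apply/exists_inP/idP => [[k Sk /eqP/val_inj <-] //|Si]; first by exists i.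
Qed.

(** A shortened row j is a corner, so it was strictly longer than row j-1 and hence than every lower
    row. *)
Lemma remove_corners_shape l S :
  is_shape l -> S \subset corners l -> is_shape (remove_corners l S).
Proof.
move=> l_shape /subsetP S_corners i j /andP[le_ij lt_jn].
have lt_in := leq_ltn_trans le_ij lt_jn.
have [->//|ne_ij] := eqVneq i j.
have -> := remove_cornersE l S (Ordinal lt_in).
have -> := remove_cornersE l S (Ordinal lt_jn).
have le_lij : (l i <= l j)%N by apply: l_shape; rewrite le_ij.
case: (boolP (Ordinal lt_jn \in S)) => [/S_corners|_] /=; last by lia.
rewrite inE /=; case: j => [|j] /= in le_ij lt_jn ne_ij le_lij * => //; first lia.
have : (l i <= l j)%N by apply: l_shape; lia.
by lia.
Qed.

(* Pascal's rule splits row i into a copy with p-1 and a copy with p-1 and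
   l i decreased; when i is not a corner the latter is row i-1, and can be
   subtracted. *)
Lemma shape_det_rec l p : is_shape l ->
  shape_det l p =
  \sum_(S : {set 'I_n} | S \subset corners l)
     shape_det (remove_corners l S) (p - 1).
Proof.
move=> l_shape.
pose U : 'M[int]_n := \matrix_(i, k)
  ((i == k)%:R - ((k.+1 == i) && (i \notin corners l))%:R).
pose F (i j : 'I_n) : int :=
  gbinom (p - 1 + (i : nat)%:Z) ((l i + i)%N%:Z - (j : nat)%:Z).
pose G (i j : 'I_n) : int :=
  gbinom (p - 1 + (i : nat)%:Z) ((l i + i)%N%:Z - (j : nat)%:Z - 1)
    *+ (i \in corners l).
have detU : \det U = 1.
  rewrite det_trig; last first.
    apply/is_trig_mxP => i j lt_ij; rewrite mxE.
    by rewrite (ltn_eqF lt_ij : (i == j) = false) (gtn_eqF (leqW lt_ij)) subr0.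
  by rewrite big1 // => i _; rewrite mxE eqxx (gtn_eqF (leqnn _)) subr0.
transitivity (\det U * shape_det l p); first by rewrite detU mul1r.
rewrite -det_mulmx.
have -> : U *m (\matrix_(i, j) gbinom (p + (i : nat)%:Z)
             ((l i + i)%N%:Z - (j : nat)%:Z)) = \matrix_(i, j) (G i j + F i j).
  apply/matrixP => i j; rewrite !mxE.
  under eq_bigr => k _ do rewrite !mxE mulrBl.
  rewrite sumrB (bigD1 i) //= eqxx mul1r big1 ?addr0; last first.
    by move=> k /negPf ne_ki; rewrite eq_sym ne_ki mul0r.
  rewrite gbinom_pascal /F /G -addrA addrC.
  rewrite [X in _ + X](_ : _ = gbinom (p - 1 + i%:Z) ((l i + i)%N%:Z - j%:Z));
    last by congr gbinom; ring.
  congr (_ + _).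
  have [ic|inc] := boolP (i \in corners l).
    rewrite big1 ?subr0; last by move=> k _; rewrite andbF mul0r.
    by congr gbinom; ring.
  rewrite mulr0n; move: inc; rewrite inE -leqNgt.
  case: i => [[|i] lt_in] /= le_l.
    rewrite big1 ?subr0; last by move=> k _; rewrite mul0r.
    by apply: gbinom_neg; lia.
  have lt_in' : (i < n)%N by lia.
  rewrite (bigD1 (Ordinal lt_in')) //= eqxx mul1r big1 ?addr0; last first.
    move=> k ne_k; rewrite eqSS; case: eqP => [eq_ki|]; rewrite ?mul0r //.
    by case/eqP: ne_k; apply: val_inj.
  have -> : l i.+1 = l i.
    by apply/eqP; rewrite eqn_leq le_l /=; apply: l_shape; lia.
  by apply/eqP; rewrite subr_eq0; apply/eqP; congr gbinom; lia.
(* Multilinearity: each row chooses its [G] or its [F] part, and S collects the rows choosing [G].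
   Since [G] vanishes off the corners, only sets of corners contribute. *)
rewrite /determinant.
under eq_bigr => s _.
  under eq_bigr => i _ do rewrite mxE.
  rewrite bigA_distr mulr_sumr.
  over.
rewrite exchange_big [RHS]big_mkcond /=; apply: eq_bigr => S _.
have [S_corners | /subsetPn[i Si inc]] := boolP (S \subset corners l).
  apply: eq_bigr => s _; congr (_ * _); apply: eq_bigr => i _.
  rewrite mxE remove_cornersE /F /G; case: (boolP (i \in S)) => [Si|_].
    have ic := subsetP S_corners _ Si; rewrite ic mulr1n.
    rewrite subn1; move: ic; rewrite inE => lt_l.
    by congr gbinom; lia.
  by rewrite subn0.
rewrite big1 // => s _; rewrite (bigD1 i) //= Si /G (negPf inc).
by rewrite mulr0n mul0r mulr0.
Qed.

(** For the empty shape the matrix is lower unitriangular. Otherwise the top row of the diagram is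
    nonempty, and the last matrix row consists of binomials with upper entry 1-n+(n-1) = 0 and
    positive lower entry. *)
Lemma shape_det_base l : is_shape l ->
  shape_det l (1 - n%:Z) = [forall i : 'I_n, l i == 0%N]%:R.
Proof.
move=> l_shape; case: (boolP [forall i, _]) => [/forallP l0 | /forallPn[i li]].
  rewrite /shape_det det_trig.
    by rewrite big1 // => i _; rewrite mxE (eqP (l0 i)) add0n subrr gbinomx0.
  apply/is_trig_mxP => i j lt_ij.
  by rewrite mxE (eqP (l0 i)) gbinom_neg //; lia.
have lt_n : (n.-1 < n)%N by have := ltn_ord i; lia.
rewrite /shape_det (expand_det_row _ (Ordinal lt_n)) big1 // => j _; rewrite mxE /=.
have le_l : (l i <= l n.-1)%N by apply: l_shape; have := ltn_ord i; lia.
rewrite (_ : 1 - n%:Z + n.-1%:Z = 0%N); last by lia.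
rewrite (_ : (l n.-1 + n.-1)%N%:Z - j%:Z = (l n.-1 + n.-1 - j)%N); last first.
  by have := ltn_ord j; lia.
by rewrite gbinom_small ?mul0r //; have := ltn_ord j; lia.
Qed.

Lemma shape_det_ext l l' p :
  (forall i : 'I_n, l i = l' i) -> shape_det l p = shape_det l' p.
Proof. by move=> ll'; congr (\det _); apply/matrixP => i j; rewrite !mxE ll'. Qed.

(** * Diagrams of shapes and their corner cells *)

Variable w : nat.

Definition diagram l := [set x : 'I_n * 'I_w | (x.2 < l x.1)%N].

Lemma in_diagram l x : (x \in diagram l) = (x.2 < l x.1)%N.
Proof. by rewrite inE. Qed.

Definition bounded l := forall i : 'I_n, (l i <= w)%N.

(* y is the right or lower neighbour of x, as rows are numbered from bottom
   to top. *)
Definition adj (x y : 'I_n * 'I_w) : bool :=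
  (x.1 == y.1 :> nat) && (y.2 == x.2.+1 :> nat)
  || (x.1 == y.1.+1 :> nat) && (x.2 == y.2 :> nat).

(** One-based row number from the top plus zero-based column. It is a rank function for [adj] and,
    on a shape, a lower bound for the entries of strict fillings. *)
Definition depth (x : 'I_n * 'I_w) : nat := (n - x.1 + x.2)%N.

Lemma adj_depth x y : adj x y -> (depth x < depth y)%N.
Proof.
by rewrite /adj /depth; have := ltn_ord x.1; have := ltn_ord y.1; lia.
Qed.

Lemma remove_corners_bounded l S : bounded l -> bounded (remove_corners l S).
Proof. by move=> lw i; rewrite remove_cornersE; have := lw i; lia. Qed.

Lemma diagram_eq0 l : bounded l ->
  (diagram l == set0) = [forall i : 'I_n, l i == 0%N].
Proof.
move=> lw; apply/eqP/forallP => [D0 i | l0].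
  case: posnP => // li_gt0.
  have /setP/(_ (i, Ordinal (leq_trans li_gt0 (lw i)))) := D0.
  by rewrite !inE /= li_gt0.
by apply/setP => x; rewrite !inE (eqP (l0 x.1)).
Qed.

(** Having no right neighbour puts the cell at the end of its row; having no lower neighbour makes
    the row below shorter. *)
Lemma mem_maxels l x : is_shape l -> bounded l ->
  (x \in maxels _ adj (diagram l)) = (x.1 \in corners l) && (x.2.+1 == l x.1).
Proof.
case: x => i c l_shape lw; rewrite [i \in _]inE /=.
have lt_in := ltn_ord i; have le_lw := lw i.
apply/maxelsP/andP => [[]|[lt_il /eqP eq_cl]]; rewrite inE /=.
  move=> lt_cl max_x.
  have eq_cl : c.+1 == l i.
    rewrite eqn_leq lt_cl /= leqNgt; apply/negP => lt_cl'.
    have lt_cw : (c.+1 < w)%N by exact: leq_trans lt_cl' (lw i).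
    have := max_x (i, Ordinal lt_cw).
    by rewrite inE /= lt_cl' /adj /= !eqxx => /(_ isT).
  split=> //; case: i => [[|i] lt_in'] /= in lt_in le_lw lt_cl max_x eq_cl *; first by lia.
  rewrite -(eqP eq_cl) ltnS leqNgt; apply/negP => lt_cl'.
  have := max_x (Ordinal (ltnW lt_in), c).
  by rewrite inE /= lt_cl' /adj /= !eqxx orbT => /(_ isT).
split; first by lia.
case=> j d; rewrite inE /adj /= => lt_dl; apply/negP => /orP[] /andP[/eqP eq_ij].
  by rewrite -eq_ij in lt_dl; lia.
by move=> /eqP eq_cd; rewrite eq_ij /= in lt_il eq_cl; lia.
Qed.

(** A corner row contains exactly one maximal cell, so the first projection matches sets of maximal
    cells with sets of corners. This brings the recursions for fillings to the form of
    [shape_det_rec]. *)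
Lemma sum_maxels l (F : {set 'I_n * 'I_w} -> nat -> int) :
    is_shape l -> bounded l ->
  \sum_(S : {set 'I_n * 'I_w} | S \subset maxels _ adj (diagram l))
     F (diagram l :\: S) #|S| =
  \sum_(S : {set 'I_n} | S \subset corners l) F (diagram (remove_corners l S)) #|S|.
Proof.
move=> l_shape lw; pose Mx := maxels _ adj (diagram l).
have fst_inj : {in Mx &, injective fst}.
  move=> [i c] [j d]; rewrite /Mx !mem_maxels //= => /andP[_ /eqP ec].
  move=> /andP[_ /eqP ed] eij; rewrite -eij in ed *; congr (_, _).
  by apply: val_inj; apply: succn_inj; rewrite ec.
rewrite (reindex_onto (fun S : {set 'I_n} => [set x in Mx | x.1 \in S])
                      (fun S : {set 'I_n * 'I_w} => [set x.1 | x in S]));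
  last first.
  move=> S /subsetP maxS; apply/setP => x; rewrite inE.
  apply/andP/idP => [[Mx_x /imsetP[y Sy exy]]|Sx].
    by rewrite (fst_inj _ _ Mx_x (maxS _ Sy) exy).
  by split; [exact: maxS | exact: imset_f].
have fst_lift S : S \subset corners l -> [set x.1 | x in [set x in Mx | x.1 \in S]] = S.
  move=> /subsetP Sc; apply/setP => i; apply/imsetP/idP => [[x]|Si].
    by rewrite inE => /andP[_ Sx] ->.
  have := Sc _ Si; rewrite inE => lt_il.
  have lt_w : ((l i).-1 < w)%N by have := lw i; lia.
  exists (i, Ordinal lt_w); rewrite // inE /Mx mem_maxels //= Si Sc //= andbT.
  by apply/eqP; lia.
have lift_max S : [set x in Mx | x.1 \in S] \subset Mx.
  by apply/subsetP => x; rewrite inE => /andP[].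
apply: eq_big => [S|S /andP[_ /eqP eS]].
  rewrite lift_max /=; apply/eqP/idP => [<-|]; last exact: fst_lift.
  apply/subsetP => i /imsetP[x]; rewrite inE => /andP[Mx_x _] ->.
  by move: Mx_x; rewrite /Mx mem_maxels // => /andP[].
rewrite -[in RHS]eS card_in_imset; last first.
  by move=> x y /(subsetP (lift_max S)) Mx_x /(subsetP (lift_max S)); apply: fst_inj.
congr (F _ _); rewrite eS; apply/setP => x.
rewrite in_setD [X in ~~ X]in_set !in_diagram remove_cornersE.
have Sc : S \subset corners l.
  rewrite -eS; apply/subsetP => i /imsetP[y]; rewrite inE => /andP[My _] ->.
  by move: My; rewrite /Mx mem_maxels // => /andP[].
have := mem_maxels _ x l_shape lw; rewrite -/Mx.
case: (boolP (x.1 \in S)) => [Sx|_] /=; last by rewrite subn0 andbF.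
by rewrite (subsetP Sc _ Sx) andbT => ->; apply/idP/idP; lia.
Qed.

(** * Shape determinants as signed counts of fillings *)

Variable M : nat.

Lemma shape_det_strict l k : is_shape l -> bounded l -> (k <= M)%N ->
  shape_det l (1 - n%:Z + k%:Z) = #|fillings _ adj M ltn (diagram l) k|%:Z.
Proof.
elim: k l => [|k IHk] l l_shape lw le_kM.
  by rewrite addr0 shape_det_base // card_fillings0 diagram_eq0 //; case: [forall _, _].
rewrite shape_det_rec // card_strict_fillings_rec // -[RHS]natz natr_sum.
rewrite (sum_maxels _ (fun A _ => #|fillings _ adj M ltn A k|%:R)) //.
apply: eq_bigr => S Sc; rewrite natz -IHk.
- by congr shape_det; lia.
- exact: remove_corners_shape.
- exact: remove_corners_bounded.
- exact: ltnW.
Qed.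

Lemma sum_remove_corners l S : S \subset corners l ->
  (\sum_(i < n) l i = \sum_(i < n) remove_corners l S i + #|S|)%N.
Proof.
move=> /subsetP Sc; rewrite -sum1_card [X in (_ + X)%N]big_mkcond -big_split /=.
apply: eq_bigr => i _; rewrite remove_cornersE.
by case: (boolP (i \in S)) => [/Sc|_] /=; rewrite ?inE; lia.
Qed.

(** Expand both sides of the identity for k by their recursions. The terms with S empty are the two
    sides for k+1; the terms with S nonempty agree by an inner induction on the number of boxes, the
    sign (-1)^|S| accounting for the removed cells. *)
Lemma shape_det_weak l k : is_shape l -> bounded l -> (k <= M)%N ->
  (-1) ^+ (\sum_(i < n) l i)%N * shape_det l (1 - n%:Z - k%:Z) =
  #|fillings _ adj M leq (diagram l) k|%:Z.
Proof.
elim: k l => [|k IHk] l l_shape lw le_kM.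
  rewrite subr0 shape_det_base // card_fillings0 diagram_eq0 //.
  case: (boolP [forall _, _]) => [/forallP l0 | _]; last by rewrite mulr0.
  by rewrite big1 ?mulr1 // => i _; apply/eqP.
have [m] := ubnP (\sum_(i < n) l i)%N.
elim: m l l_shape lw => [|m IHm] l l_shape lw //; rewrite ltnS => le_lm.
rewrite (_ : 1 - n%:Z - k.+1%:Z = 1 - n%:Z - k%:Z - 1); last by lia.
have := IHk l l_shape lw (ltnW le_kM).
rewrite (card_weak_fillings_rec _ _ _ depth) //; last exact: adj_depth.
rewrite (sum_maxels _ (fun A s => (-1) ^+ s * #|fillings _ adj M leq A k.+1|%:Z)) //.
rewrite shape_det_rec // mulr_sumr (bigD1 set0) ?sub0set //=.
rewrite [RHS](bigD1 set0) ?sub0set //= cards0 expr0 mul1r.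
have remove0 (i : 'I_n) : remove_corners l set0 i = l i.
  by rewrite remove_cornersE in_set0 subn0.
rewrite (shape_det_ext _ l) //.
rewrite (_ : diagram (remove_corners l set0) = diagram l); last first.
  by apply/setP => x; rewrite !inE remove0.
set u := (X in X + _ = _); set v := (X in _ = X + _).
set s1 := (X in _ + X = _); set s2 := (X in _ = _ + X).
suff -> : s1 = s2 by move/addIr.
apply: eq_bigr => S /andP[Sc S0]; have sumS := sum_remove_corners l S Sc.
rewrite sumS addnC exprD -mulrA -IHm.
- by congr (_ * (_ * shape_det _ _)); lia.
- exact: remove_corners_shape.
- exact: remove_corners_bounded.
- by move: S0; rewrite -card_gt0; lia.
Qed.

(** From any cell go left to the first column, then up to the top row: the depth drops by one at
    each step while the entry drops by at least one, and the top left cell has depth 1 and a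
    positive entry. *)
Lemma strict_filling_depth l k f x :
    is_shape l -> bounded l -> f \in fillings _ adj M ltn (diagram l) k ->
  x \in diagram l -> (depth x <= f x)%N.
Proof.
move=> l_shape lw /fillingsP[fA fk fr].
have [m] := ubnP (depth x); elim: m x => // m IHm x; rewrite ltnS => le_xm Dx.
have step y : y \in diagram l -> adj y x -> depth x = (depth y).+1 ->
    (depth x <= f x)%N.
  move=> Dy ayx exy; rewrite exy; apply: leq_ltn_trans (fr _ _ Dy Dx ayx).
  by apply: IHm => //; rewrite -exy.
have := Dx; rewrite inE; case: x => i [[|c] lt_cw] /= in le_xm Dx step *; last first.
  move=> lt_cl; apply: (step (i, Ordinal (ltnW lt_cw))).
  - by rewrite inE ltnW.
  - by rewrite /adj /= !eqxx.
  - by rewrite /depth /= addnS.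
move=> li_gt0; have := ltn_ord i; rewrite leq_eqVlt => /predU1P[ein|lt_in].
  have : (0 < f (i, Ordinal lt_cw))%N by rewrite -fA.
  by rewrite /depth /= addn0; lia.
apply: (step (Ordinal lt_in, Ordinal lt_cw)).
- by rewrite inE /=; apply: leq_trans li_gt0 (l_shape _ _ _); rewrite leqnSn.
- by rewrite /adj /= !eqxx orbT.
- by rewrite /depth /=; lia.
Qed.

(** The depth itself is a strict filling; in row i it is at most n - i + l i - 1, hence at most n -
    1. *)
Lemma strict_fillings_gt0 l k :
    (forall i : 'I_n, (l i <= i)%N) -> (n <= k.+1)%N -> (k <= M)%N ->
  (0 < #|fillings _ adj M ltn (diagram l) k|)%N.
Proof.
move=> li le_nk le_kM; apply/card_gt0P.
exists [ffun x => if x \in diagram l then inord (depth x) else ord0].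
have depthE x : x \in diagram l -> (0 < depth x <= k)%N.
  case: x => i c; rewrite in_diagram /depth /=.
    by have := ltn_ord i; have := li i; lia.
have inordE x : x \in diagram l -> (inord (depth x) : 'I_M.+1) = depth x :> nat.
  by move=> /depthE/andP[_ le_xk]; rewrite inordK // ltnS (leq_trans le_xk).
apply/fillingsP; split=> [x|x|x y Dx Dy]; rewrite !ffunE.
- by case: (boolP (x \in _)) => // Dx; rewrite inordE //; case/andP: (depthE _ Dx).
- by case: (boolP (x \in _)) => // Dx; rewrite inordE //; case/andP: (depthE _ Dx).
- by rewrite Dx Dy !inordE //; apply: adj_depth.
Qed.

Lemma weak_fillings_gt0 l k : (0 < k <= M)%N ->
  (0 < #|fillings _ adj M leq (diagram l) k|)%N.
Proof.
move=> /andP[k_gt0 le_kM]; apply/card_gt0P.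
exists [ffun x => if x \in diagram l then inord 1 else ord0].
apply/fillingsP; split=> [x|x|x y Dx Dy]; rewrite !ffunE ?Dx ?Dy //;
  by case: ifP; rewrite // inordK //; lia.
Qed.

End Shapes.

(** * Young diagrams *)

(** Passes from fillings that vanish outside A to functions defined only on the cells, A being the
    image of h. *)
Lemma card_fillings_embed (T C : finType) (e : rel T) (h : C -> T) (M k : nat)
    (r : rel nat) (A : {set T}) :
  injective h -> A =i codom h ->
  #|fillings T e M r A k| =
  #|[set g : {ffun C -> 'I_M.+1} | [forall c, (0 < g c <= k)%N] &&
       [forall c, forall d, e (h c) (h d) ==> r (g c) (g d)]]|.
Proof.
move=> h_inj Ah.
have Ahc c : h c \in A by rewrite Ah codom_f.
pose ext (g : {ffun C -> 'I_M.+1}) : {ffun T -> 'I_M.+1} :=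
  [ffun x => if [pick c | h c == x] is Some c then g c else ord0].
have extE g c : ext g (h c) = g c.
  rewrite ffunE; case: pickP => [d /eqP/h_inj -> //|/(_ c)].
  by rewrite eqxx.
apply: (@card_can_eq _ _ _ _
  (fun f : {ffun T -> 'I_M.+1} => [ffun c => f (h c)]) ext) => [f|g|f|g].
- case/fillingsP => fA fk fr; rewrite inE; apply/andP; split.
    by apply/forallP => c; rewrite ffunE -fA Ahc fk.
  by apply/forallP => c; apply/forallP => d; rewrite !ffunE; apply/implyP/fr.
- rewrite inE => /andP[/forallP gk /forallP gr]; apply/fillingsP; split.
  + move=> x; rewrite Ah; apply/codomP/idP => [[c ->]|].
      by rewrite extE; case/andP: (gk c).
    by rewrite ffunE; case: pickP => // c /eqP <- _; exists c.
  + by move=> x; rewrite ffunE; case: pickP => // c _; case/andP: (gk c).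
  + move=> x y; rewrite !Ah => /codomP[c ->] /codomP[d ->]; rewrite !extE.
    by move/forallP: (gr c) => /(_ d)/implyP.
- case/fillingsP => fA fk fr; apply/ffunP => x; rewrite ffunE.
  case: pickP => [c /eqP <-|h0]; first by rewrite ffunE.
  apply/val_inj/esym/eqP; rewrite /= -leqn0 leqNgt -fA Ah.
  by apply/codomP => -[c ex]; have := h0 c; rewrite ex eqxx.
- by move=> _; apply/ffunP => c; rewrite ffunE extE.
Qed.

Section Cells.
Variable lam : seq nat.
Local Notation n := (size lam).
Local Notation w := (sumn lam).

(** The reversal reflects that [lam] lists rows from the top while shapes number them from the
    bottom. *)
Definition row_len (i : nat) : nat := nth 0%N lam (n - i.+1).

Definition cell_pos (x : cell lam) : 'I_n * 'I_w :=
  (rev_ord (val x).1, (val x).2).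

Lemma cell_pos_inj : injective cell_pos.
Proof.
case=> [[i c] ?] [[j d] ?]; rewrite /cell_pos /= => -[eij ecd].
apply: val_inj; rewrite /= ecd; congr (_, _); apply: val_inj => /=.
by have := ltn_ord i; have := ltn_ord j; lia.
Qed.

Lemma diagram_cell_pos : diagram n w row_len =i codom cell_pos.
Proof.
move=> [i c]; rewrite in_diagram /= /row_len; apply/idP/codomP => [lt_c|[[[j d] lt_d] [-> ->]]].
  by exists (exist _ (rev_ord i, c) lt_c); rewrite /cell_pos /= rev_ordK.
have := ltn_ord j; rewrite /= => lt_jn.
by rewrite (_ : (n - (n - j.+1).+1)%N = j); [exact: lt_d | lia].
Qed.

Lemma adj_cell_pos (x y : cell lam) :
  adj n w (cell_pos x) (cell_pos y) = right_adj x y || below_adj x y.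
Proof.
rewrite /adj /right_adj /below_adj /=.
case: (val x) (val y) => [i c] [j d] /=.
have := ltn_ord i; have := ltn_ord j.
by move: (i : nat) (j : nat) (c : nat) (d : nat); lia.
Qed.

Lemma row_len_bounded : bounded n w row_len.
Proof.
move=> i; rewrite /row_len.
have nth_le_sumn s k : (nth 0 s k <= sumn s)%N.
  elim: s k => [|x s IHs] [|k] //=; first exact: leq_addr.
  exact: leq_trans (IHs k) (leq_addl _ _).
exact: nth_le_sumn.
Qed.

Lemma card_strict_fillings k :
  #|strict_fillings lam k.+1| =
  #|fillings _ (adj n w) k ltn (diagram n w row_len) k|.
Proof.
rewrite (card_fillings_embed _ _ _ _ _ _ _ _ cell_pos_inj diagram_cell_pos).
apply: eq_card => g; rewrite !inE; congr (_ && _).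
  by apply: eq_forallb => c; have := ltn_ord (g c); rewrite ltnS => ->; rewrite andbT.
by apply: eq_forallb => c; apply: eq_forallb => d; rewrite adj_cell_pos.
Qed.

(** Entries are shifted from {0,...,K} to {1,...,K+1}, because in [fillings] the value 0 marks the
    cells outside the diagram. *)
Lemma card_weak_fillings K :
  #|weak_fillings lam K| =
  #|fillings _ (adj n w) K.+1 leq (diagram n w row_len) K.+1|.
Proof.
rewrite (card_fillings_embed _ _ _ _ _ _ _ _ cell_pos_inj diagram_cell_pos).
apply: (@card_can_eq _ _ _ _
  (fun g : {ffun cell lam -> 'I_K.+1} => [ffun c => lift ord0 (g c)])
  (fun g => [ffun c => inord (g c).-1])) => g.
- rewrite !inE => /forallP gr; apply/andP; split; apply/forallP => c.
    by rewrite ffunE lift0 ltn_ord.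
  apply/forallP => d; rewrite adj_cell_pos !ffunE !lift0 ltnS.
  by move/forallP: (gr c); apply.
- rewrite !inE => /andP[/forallP gk /forallP gr].
  apply/forallP => c; apply/forallP => d; apply/implyP => acd.
  have /implyP := forallP (gr c) d; rewrite adj_cell_pos => /(_ acd).
  have /andP[c_gt0 le_cK] := gk c; have /andP[d_gt0 le_dK] := gk d.
  by rewrite !ffunE !inordK ?prednK //= -!subn1 => /leq_sub2r.
- move=> _; apply/ffunP => c; rewrite !ffunE; apply: val_inj.
  by rewrite lift0 /= inordK.
- rewrite inE => /andP[/forallP gk _]; apply/ffunP => c; rewrite !ffunE.
  by apply: val_inj; case/andP: (gk c) => *; rewrite [LHS]lift0 inordK ?prednK.
Qed.

Hypothesis lam_shape : is_shape n row_len.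

Lemma shape_det_strict_fillings k :
  shape_det n row_len (1 - n%:Z + k%:Z) = #|strict_fillings lam k.+1|%:Z.
Proof.
rewrite card_strict_fillings; apply: shape_det_strict => //.
exact: row_len_bounded.
Qed.

Lemma shape_det_weak_fillings K :
  (-1) ^+ (\sum_(i < n) row_len i)%N * shape_det n row_len (- n%:Z - K%:Z) =
  #|weak_fillings lam K|%:Z.
Proof.
rewrite card_weak_fillings -shape_det_weak //; last exact: row_len_bounded.
(* With K+1 admissible values the argument 1 - n - (K+1) is -n - K. *)
by congr (_ * shape_det _ _ _); lia.
Qed.

Lemma card_strict_fillings_gt0 k :
    (forall i : 'I_n, (row_len i <= i)%N) -> (n <= k.+1)%N ->
  (0 < #|strict_fillings lam k.+1|)%N.
Proof. by move=> li le_nk; rewrite card_strict_fillings strict_fillings_gt0. Qed.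

Lemma card_weak_fillings_gt0 K : (0 < #|weak_fillings lam K|)%N.
Proof. by rewrite card_weak_fillings weak_fillings_gt0 ?leqnn. Qed.

Lemma card_weak_fillings0 : #|weak_fillings lam 0| = 1%N.
Proof.
rewrite (_ : weak_fillings lam 0 = setT) ?cardsT ?card_ffun ?card_ord ?exp1n //.
apply/setP => f; rewrite !inE; apply/forallP => x; apply/forallP => y.
by rewrite !ord1 implybT.
Qed.

(** The last cell of row i has depth n - i + l i - 1, which bounds its entry from below, and that
    entry is at most k. *)
Lemma strict_fillings_row_len k (i : 'I_n) :
    (0 < #|strict_fillings lam k.+1|)%N -> (0 < row_len i)%N ->
  (n + row_len i <= k.+1 + i)%N.
Proof.
rewrite card_strict_fillings => /card_gt0P[f Df] li_gt0.
have lt_w : ((row_len i).-1 < w)%N by have := row_len_bounded i; lia.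
have Dx : (i, Ordinal lt_w) \in diagram n w row_len by rewrite in_diagram /=; lia.
have := strict_filling_depth _ _ _ _ _ _ _ lam_shape row_len_bounded Df Dx.
have /fillingsP[_ /(_ (i, Ordinal lt_w)) le_k _] := Df.
by move=> /leq_trans/(_ le_k); rewrite /depth /=; have := ltn_ord i; lia.
Qed.

End Cells.

(** * Matchings *)

Lemma nth_sorted_leq_count (s : seq nat) (k i : nat) :
  sorted ltn s -> (i < size s)%N ->
  (nth 0%N s i <= k)%N = (i < count (fun v => v <= k)%N s)%N.
Proof.
elim: s i => //= x s IHs i path_s lt_is; have [le_xk|lt_kx] := leqP x k.
  case: i lt_is => [|i] lt_is /=; first by rewrite le_xk.
  by rewrite add1n ltnS IHs // (path_sorted path_s).
have s_gtk : all (fun v => k < v)%N s.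
  have /allP x_min := order_path_min ltn_trans path_s.
  by apply/allP => v /x_min /=; apply: ltn_trans.
rewrite (_ : count _ s = 0%N); last first.
  apply/eqP; rewrite -leqn0 leqNgt -has_count -all_predC.
  by apply: sub_all s_gtk => v /=; rewrite -ltnNge.
rewrite ltn0; apply/negbTE; rewrite -ltnNge.
case: i lt_is => [|i] //= lt_is; rewrite -[(_ < _)%N]/((fun v => k < v)%N _).
exact: (allP s_gtk) (mem_nth _ lt_is).
Qed.

Lemma count_leq_iota (k N : nat) :
  count (fun v => v <= k)%N (iota 1 N) = minn k N.
Proof.
elim: N => [|N IHN]; first by rewrite minn0.
by rewrite -[N.+1]addn1 iotaD count_cat IHN /=; lia.
Qed.

Lemma perm_flatten_pairs (T : eqType) (m : seq (T * T)) :
  perm_eq (flatten [seq [:: x.1; x.2] | x <- m]) (map fst m ++ map snd m).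
Proof.
apply/permP => p; rewrite count_cat !count_map.
by elim: m => //= x m ->; lia.
Qed.

Lemma uniq_map_inj (T1 T2 : eqType) (f : T1 -> T2) (s : seq T1) :
  uniq (map f s) -> {in s &, injective f}.
Proof.
elim: s => //= x s IHs /andP[fx_notin /IHs f_inj] y z.
rewrite !inE => /predU1P[->|sy] /predU1P[->|sz] //; last exact: f_inj.
- by move=> exz; case/negP: fx_notin; rewrite exz map_f.
- by move=> eyx; case/negP: fx_notin; rewrite -eyx map_f.
Qed.

Section Matchings.
Variables (n : nat) (m : seq (nat * nat)).
Hypothesis m_matching : is_matching n m.
Implicit Types (x y : nat * nat) (i j k v : nat).

Lemma arch_lt x : x \in m -> (x.1 < x.2)%N.
Proof. by case: m_matching => /allP m_lt _ _; apply: m_lt. Qed.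

Lemma arch_noncrossing x y :
  x \in m -> y \in m -> ~~ [&& x.1 < y.1, y.1 < x.2 & x.2 < y.2]%N.
Proof. by case: m_matching => _ _; apply. Qed.

Lemma perm_endpoints : perm_eq (map fst m ++ map snd m) (iota 1 (2 * n)).
Proof.
case: m_matching => _ m_perm _.
by rewrite (perm_trans _ m_perm) // perm_sym perm_flatten_pairs.
Qed.

Lemma size_matching : size m = n.
Proof.
have /perm_size := perm_endpoints.
by rewrite size_cat !size_map size_iota; lia.
Qed.

Lemma uniq_endpoints : uniq (map fst m ++ map snd m).
Proof. by rewrite (perm_uniq perm_endpoints) iota_uniq. Qed.

Lemma arch_fst_inj x y : x \in m -> y \in m -> x.1 = y.1 -> x = y.
Proof.
have := uniq_endpoints; rewrite cat_uniq => /and3P[fst_uniq _ _].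
exact: uniq_map_inj fst_uniq x y.
Qed.

Lemma arch_snd_inj x y : x \in m -> y \in m -> x.2 = y.2 -> x = y.
Proof.
have := uniq_endpoints; rewrite cat_uniq => /and3P[_ _ snd_uniq].
exact: uniq_map_inj snd_uniq x y.
Qed.

Lemma arch_fst_snd x y : x \in m -> y \in m -> x.1 != y.2.
Proof.
move=> mx my; have := uniq_endpoints; rewrite cat_uniq => /and3P[_ + _].
apply: contraNneq => exy; apply/hasP; exists y.2; first exact: map_f.
by rewrite /= -exy map_f.
Qed.

Lemma endpointP v : (1 <= v <= 2 * n)%N ->
  exists2 x, x \in m & x.1 = v \/ x.2 = v.
Proof.
move=> v_range; have : v \in map fst m ++ map snd m.
  by rewrite (perm_mem perm_endpoints) mem_iota; lia.
by rewrite mem_cat => /orP[] /mapP[x mx ->]; exists x; auto.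
Qed.

Lemma endpoint_range x : x \in m -> (1 <= x.1)%N /\ (x.2 <= 2 * n)%N.
Proof.
move=> mx; split.
  have : x.1 \in map fst m ++ map snd m by rewrite mem_cat map_f.
  by rewrite (perm_mem perm_endpoints) mem_iota; lia.
have : x.2 \in map fst m ++ map snd m by rewrite mem_cat map_f ?orbT.
by rewrite (perm_mem perm_endpoints) mem_iota; lia.
Qed.

(** [opens k] and [closes k] count the up and down steps among the first k steps of the Dyck path;
    their difference is its height. *)
Definition opens k := count (fun x => x.1 <= k)%N m.
Definition closes k := count (fun x => x.2 <= k)%N m.

Lemma opensDcloses k : (opens k + closes k = minn k (2 * n))%N.
Proof.
rewrite -count_leq_iota -(permP perm_endpoints) count_cat !count_map.
by congr addn; apply: eq_count.
Qed.

Lemma leq_closes_opens k : (closes k <= opens k)%N.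
Proof.
rewrite /closes /opens; have : all (fun x => x.1 < x.2)%N m by case: m_matching.
by elim: m => //= x m' IHm /andP[lt_x /IHm]; lia.
Qed.

Lemma opens_le_n k : (opens k <= n)%N.
Proof. by rewrite -size_matching count_size. Qed.

Lemma aseq_sorted : sorted ltn (aseq m).
Proof.
have := uniq_endpoints; rewrite cat_uniq ltn_sorted_uniq_leq sort_uniq.
by case/and3P=> -> _ _; apply: (sort_sorted leq_total).
Qed.

Lemma size_aseq : size (aseq m) = n.
Proof. by rewrite size_sort size_map size_matching. Qed.

(** Translates bounds on the a_i into bounds on the height of the path, and back. *)
Lemma avec_leq i k : (i < n)%N -> (avec m i.+1 <= k)%N = (i < opens k)%N.
Proof.
move=> lt_in; rewrite /avec /= nth_sorted_leq_count ?aseq_sorted ?size_aseq //.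
by rewrite (permP (permEl (perm_sort _ _))) count_map.
Qed.

Lemma avec_lower i : (i < n)%N -> (i < avec m i.+1)%N.
Proof.
move=> lt_in; have := avec_leq i (avec m i.+1) lt_in; rewrite leqnn => /esym.
by have := opensDcloses (avec m i.+1); lia.
Qed.

(** At least half of the first 2i+1 endpoints are openings, hence at least i+1 of them. *)
Lemma avec_upper i : (i < n)%N -> (avec m i.+1 <= i.*2.+1)%N.
Proof.
move=> lt_in; rewrite avec_leq //.
by have := opensDcloses i.*2.+1; have := leq_closes_opens i.*2.+1; lia.
Qed.

Lemma avec_ltS i : (i.+1 < n)%N -> (avec m i.+1 < avec m i.+2)%N.
Proof.
move=> lt_in; rewrite /avec /=.
by apply: (sorted_ltn_nth ltn_trans) aseq_sorted _ _ _ _ _;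
  rewrite ?inE ?size_aseq //; apply: ltnW.
Qed.

(** * The Young diagram of a matching *)

Lemma size_yshape : size (yshape n m) = n.
Proof. by rewrite size_rev size_map size_iota. Qed.

Lemma row_len_yshape i : (i < n)%N ->
  row_len (yshape n m) i = (avec m i.+1 - i.+1)%N.
Proof.
move=> lt_in; rewrite /row_len size_yshape /yshape nth_rev; last first.
  by rewrite size_map size_iota; lia.
rewrite size_map size_iota (_ : (n - (n - i.+1).+1)%N = i); last by lia.
by rewrite (nth_map 0%N) ?size_iota // nth_iota // add1n.
Qed.

Lemma yshape_shape : is_shape n (row_len (yshape n m)).
Proof.
move=> i j /andP[le_ij]; rewrite -(subnK le_ij); elim: (j - i)%N => [|d IHd] //.
rewrite addSn => lt_dn; apply: leq_trans (IHd (ltnW lt_dn)) _.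
rewrite !row_len_yshape //; last exact: ltnW.
by have := avec_ltS _ lt_dn; lia.
Qed.

Lemma Dpi_shape_det p : Dpi n m p = shape_det n (row_len (yshape n m)) p.
Proof.
congr (\det _); apply/matrixP => i j; rewrite !mxE.
rewrite row_len_yshape // addnBAC ?avec_lower //.
congr gbinom; have := avec_lower _ (ltn_ord i); lia.
Qed.

Lemma dpi_sum : dpi n m = (\sum_(i < n) row_len (yshape n m) i)%N.
Proof.
rewrite /dpi big_add1 big_mkord; apply: eq_bigr => i _.
by rewrite row_len_yshape.
Qed.

(** * Outer arches forced by short rows *)

Section Nested.
Variable q : nat.
Hypothesis lt_qn : (q < n)%N.
(** With one-based indices: a_i = i or a_i <= 2i - 1 - q. In particular the rows with i <= q+1 are
    empty. *)
Hypothesis row_small : forall i, (i < n)%N ->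
  (0 < avec m i.+1 - i.+1)%N -> (avec m i.+1 - i.+1 + q <= i)%N.

Lemma opens_initial k : (k <= q)%N -> opens k = k.
Proof.
move=> le_kq; apply/eqP; rewrite eqn_leq; apply/andP; split.
  by have := opensDcloses k; lia.
case: k le_kq => // k lt_kq; have lt_kn : (k < n)%N by lia.
have := avec_leq k k.+1 lt_kn; have := row_small k lt_kn; lia.
Qed.

Lemma closes_initial k : (k <= q)%N -> closes k = 0%N.
Proof. by move=> le_kq; have := opensDcloses k; rewrite opens_initial //; lia. Qed.

(** The last opening a_n is at most 2n - q, whether or not its row is empty. *)
Lemma opens_final k : (2 * n - q <= k)%N -> opens k = n.
Proof.
move=> le_k; apply/eqP; rewrite eqn_leq opens_le_n /=.
have lt_n : (n.-1 < n)%N by lia.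
by have := avec_leq n.-1 k lt_n; have := row_small _ lt_n; lia.
Qed.

(* The Dyck path of the matching stays at height at least q in the middle. *)
Lemma height_ge k : (q <= k <= 2 * n - q)%N -> (k + q <= (opens k).*2)%N.
Proof.
move=> /andP[le_qk le_kn]; have [lt_on|le_no] := ltnP (opens k) n; last by lia.
have := avec_leq (opens k) k lt_on; rewrite ltnn => /negbT.
have := row_small _ lt_on; lia.
Qed.

(* An arch not crossing x has both or none of its ends under x. *)
Lemma arch_between x y : x \in m -> y \in m ->
  (x.1 < y.1 <= x.2)%N || (y == x) = (x.1 < y.2 <= x.2)%N.
Proof.
move=> mx my; have lt_x := arch_lt _ mx; have lt_y := arch_lt _ my.
have [->|ne_yx] := eqVneq y x; first by rewrite orbT lt_x leqnn.
have n1 := arch_noncrossing _ _ mx my; have n2 := arch_noncrossing _ _ my mx.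
have ne1 : y.1 != x.1 by apply: contra_neq ne_yx; apply: arch_fst_inj.
have ne2 : y.2 != x.2 by apply: contra_neq ne_yx; apply: arch_snd_inj.
have ne3 := arch_fst_snd _ _ my mx; have ne4 := arch_fst_snd _ _ mx my.
by case: x y {mx my ne_yx} lt_x lt_y n1 n2 ne1 ne2 ne3 ne4 => [a b] [c d] /=; lia.
Qed.

(** The height after x.2 is one less than after x.1: an arch under x contributes both of its ends to
    the positions in between, and x only its right end. *)
Lemma arch_balanced x : x \in m ->
  (opens x.2 + closes x.1 + 1 = closes x.2 + opens x.1)%N.
Proof.
move=> mx; have lt_x := arch_lt _ mx.
have count_split (f : nat * nat -> nat) :
  (count (fun y => f y <= x.2) m =
   count (fun y => f y <= x.1) m + count (fun y => x.1 < f y <= x.2) m)%N.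
  by elim: m => //= y m' ->; lia.
rewrite /opens /closes (count_split fst) (count_split snd).
suff : (count (fun y => x.1 < y.1 <= x.2) m + 1
        = count (fun y => x.1 < y.2 <= x.2) m)%N by lia.
have m_uniq : uniq m.
  apply: (@map_uniq _ _ fst); have := uniq_endpoints.
  by rewrite cat_uniq => /and3P[].
have count_x : count (pred1 x) m = 1%N by rewrite count_uniq_mem ?mx.
rewrite -count_x -count_predUI [X in (_ + X)%N](_ : _ = 0%N); last first.
  apply/eqP; rewrite -leqn0 leqNgt -has_count; apply/hasPn => y _ /=.
  by case: eqP => [->|]; rewrite ?ltnn // andbF.
by rewrite addn0; apply: eq_in_count => y my /=; apply: arch_between.
Qed.

(** The height after x.1 = i <= q is i, so after x.2 it is i - 1 < q. This excludes the first q
    steps, which are all up, and the middle, where the height is at least q. In the final descent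
    the height is 2n - x.2, whence x.2 = 2n + 1 - i. *)
Lemma arch_initial x : x \in m -> (x.1 <= q)%N -> (x.1 + x.2 = (2 * n).+1)%N.
Proof.
move=> mx le_xq; have := arch_balanced _ mx; have [_ le_x2n] := endpoint_range _ mx.
rewrite (closes_initial x.1) // (opens_initial x.1) //.
have := opensDcloses x.2; have lt_x := arch_lt _ mx.
have [le_q|lt_q] := leqP x.2 q.
  have := opens_initial _ le_q; have := closes_initial _ le_q; lia.
have [le_n|lt_n] := leqP x.2 (2 * n - q).
  by have := height_ge x.2; rewrite (ltnW lt_q) le_n => /(_ isT); lia.
by rewrite opens_final ?(ltnW lt_n) //; lia.
Qed.

Lemma mem_initial_arch i : (1 <= i <= q)%N -> (i, (2 * n).+1 - i)%N \in m.
Proof.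
move=> /andP[i_gt0 le_iq].
have [|x mx [x1|x2]] := endpointP i; first by lia.
  have := arch_initial _ mx; rewrite x1 => /(_ le_iq) <-.
  by rewrite -x1 addKn -surjective_pairing.
have : (0 < closes i)%N by rewrite -has_count; apply/hasP; exists x; rewrite // x2.
by rewrite closes_initial.
Qed.

(** The positions after 2n - q are already the right ends of the q outer arches. *)
Lemma arch_middle x : x \in m -> (q < x.1)%N -> (x.2 <= 2 * n - q)%N.
Proof.
move=> mx lt_qx; rewrite leqNgt; apply/negP => lt_nx.
have [_ le_x2n] := endpoint_range _ mx.
have /mem_initial_arch m_arch : (1 <= (2 * n).+1 - x.2 <= q)%N by lia.
have := arch_snd_inj _ _ mx m_arch; rewrite /= => /(_ _)/(congr1 fst) /= e.
by rewrite e in lt_qx; lia.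
Qed.

(** This is the rho for which the matching is (rho)_q. *)
Definition inner_matching :=
  [seq (x.1 - q, x.2 - q)%N | x <- m & (q < x.1)%N].

Lemma mem_inner_matching v w :
  ((v, w) \in inner_matching) = (0 < v)%N && ((q + v, q + w)%N \in m).
Proof.
apply/mapP/andP => [[[a b]]|[v_gt0 mvw]].
  rewrite mem_filter => /andP[/= lt_qa mab] [-> ->].
  by have := arch_lt _ mab => /= lt_ab; rewrite !subnKC; [split=> //; lia|lia|lia].
exists (q + v, q + w)%N; rewrite ?mem_filter ?mvw /= ?addKn //; lia.
Qed.

(** The shift by q is injective on the remaining endpoints, all larger than q. An endpoint in
    q+1,...,2n-q cannot belong to an arch starting at or before q, as both ends of such an arch lie
    outside this interval. *)
Lemma perm_inner_endpoints :
  perm_eq (map fst inner_matching ++ map snd inner_matching) (iota 1 (2 * (n - q))).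
Proof.
apply: uniq_perm; [|exact: iota_uniq|].
- rewrite /inner_matching -!map_comp.
  rewrite (map_comp (subn^~ q) fst) (map_comp (subn^~ q) snd) -map_cat map_inj_in_uniq.
    apply: subseq_uniq uniq_endpoints.
    by rewrite cat_subseq // map_subseq // filter_subseq.
  have gt_q v : v \in map fst [seq x <- m | (q < x.1)%N] ++
                     map snd [seq x <- m | (q < x.1)%N] -> (q < v)%N.
    rewrite mem_cat => /orP[] /mapP[x]; rewrite mem_filter => /andP[lt_qx mx] -> //.
    exact: ltn_trans lt_qx (arch_lt _ mx).
  by move=> v w /gt_q lt_qv /gt_q lt_qw; lia.
move=> v; rewrite mem_cat mem_iota; apply/orP/idP => [|v_range].
  case=> /mapP[[a b]]; rewrite mem_inner_matching => /andP[a_gt0 mab] ->;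
    have := arch_lt _ mab; have := arch_middle _ mab; rewrite /=; lia.
have [|[a b] mab ab_v] := endpointP (q + v); first by lia.
have lt_qa : (q < a)%N.
  case: ab_v => /= ?; first by lia.
  by rewrite ltnNge; apply/negP => le_aq; have /= := arch_initial _ mab le_aq; lia.
have inner_ab : (a - q, b - q)%N \in inner_matching.
  have /= lt_ab := arch_lt _ mab.
  by rewrite mem_inner_matching subn_gt0 lt_qa !subnKC //; lia.
case: ab_v => /= e; [left|right]; apply/mapP; exists (a - q, b - q)%N => //=; lia.
Qed.

Lemma size_inner_matching : size inner_matching = (n - q)%N.
Proof.
have /perm_size := perm_inner_endpoints.
by rewrite size_cat !size_map size_iota; lia.
Qed.

Lemma inner_matchingP : is_matching (n - q) inner_matching.
Proof.
have in_inner x : x \in inner_matching -> (0 < x.1)%N /\ (q + x.1, q + x.2)%N \in m.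
  by case: x => v w; rewrite mem_inner_matching => /andP[].
split.
- by apply/allP => x /in_inner[_ /arch_lt] /=; lia.
- exact: perm_trans (perm_flatten_pairs _ _) perm_inner_endpoints.
- by move=> x y /in_inner[_ mx] /in_inner[_ my];
    have := arch_noncrossing _ _ mx my; rewrite /= !ltn_add2l.
Qed.

Lemma mem_nest_inner : m =i nest q inner_matching.
Proof.
move=> [a b]; rewrite /nest size_inner_matching mem_cat; apply/idP/orP => [mab|[]].
- have [le_aq|lt_qa] := leqP a q; [left | right].
    apply/mapP; exists a.
      by rewrite mem_iota; have [/=] := endpoint_range _ mab; lia.
    by have := arch_initial _ mab le_aq => /= ?; congr (_, _); lia.
  apply/mapP; exists (a - q, b - q)%N.
    have /= lt_ab := arch_lt _ mab.
    by rewrite mem_inner_matching subn_gt0 lt_qa !subnKC //; lia.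
  by have /= lt_ab := arch_lt _ mab; congr (_, _); lia.
- case/mapP => i; rewrite mem_iota => i_range [-> ->].
  by have := mem_initial_arch i; rewrite (_ : _ - i = (2 * n).+1 - i)%N; [apply|]; lia.
- by case/mapP => -[v w]; rewrite mem_inner_matching => /andP[_ mvw] [-> ->].
Qed.

End Nested.
End Matchings.

(** Serves matchings of size 0, where the number p + n of ordinals may be 0 and not of the form
    [k.+1]. *)
Lemma card_strict_fillings_nil (N : nat) : #|strict_fillings [::] N| = 1%N.
Proof.
have no_cell : cell [::] -> False by case=> -[[]].
pose f0 : {ffun cell [::] -> 'I_N} := [ffun x => False_rect _ (no_cell x)].
rewrite (_ : strict_fillings _ _ = [set f0]) ?cards1 //.
apply/setP => f; rewrite in_set1 inE; apply/idP/eqP => [_|_].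
  by apply/ffunP => x; case: (no_cell x).
by apply/andP; split; apply/forallP => x; case: (no_cell x).
Qed.

(** * The determinant of a matching *)

Section MatchingDeterminant.
Variables (n : nat) (m : seq (nat * nat)).
Hypothesis m_matching : is_matching n m.
Let lam := yshape n m.
Let size_lam : size lam = n := size_yshape n m.

Lemma lam_shape : is_shape (size lam) (row_len lam).
Proof. by rewrite size_lam; apply: yshape_shape. Qed.

Lemma Dpi_strict_fillings (k : nat) :
  Dpi n m (1 - n%:Z + k%:Z) = #|strict_fillings lam k.+1|%:Z.
Proof.
rewrite Dpi_shape_det // -shape_det_strict_fillings ?size_lam //.
exact: yshape_shape.
Qed.

Lemma Dpi_weak_fillings (K : nat) :
  (-1) ^+ dpi n m * Dpi n m (- n%:Z - K%:Z) = #|weak_fillings lam K|%:Z.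
Proof.
rewrite Dpi_shape_det // dpi_sum // -shape_det_weak_fillings ?size_lam //.
exact: yshape_shape.
Qed.

Lemma card_strict_yshape_gt0 (k : nat) :
  (n <= k.+1)%N -> (0 < #|strict_fillings lam k.+1|)%N.
Proof.
move=> le_nk; apply: card_strict_fillings_gt0; rewrite size_lam // => i.
rewrite row_len_yshape //; have := avec_upper _ _ m_matching _ (ltn_ord i); lia.
Qed.

Lemma Dpi_neq0_nested (q : nat) : (q < n)%N -> Dpi n m (- q%:Z) != 0 ->
  m =i nest q (inner_matching m q) /\ is_matching (n - q) (inner_matching m q).
Proof.
(* The largest entry k = n - q - 1 corresponds to p = -q; for it the row bound n + l i <= k + 1 + i
   becomes l i + q <= i. *)
move=> lt_qn; rewrite (_ : - q%:Z = 1 - n%:Z + (n - q.+1)%N%:Z); last by lia.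
rewrite Dpi_strict_fillings eqz_nat -lt0n => F_gt0.
have row_small i : (i < n)%N ->
  (0 < avec m i.+1 - i.+1)%N -> (avec m i.+1 - i.+1 + q <= i)%N.
  move=> lt_in; rewrite -(row_len_yshape n) // => li_gt0.
  have lt_i : (i < size lam)%N by rewrite size_lam.
  have := strict_fillings_row_len _ lam_shape _ (Ordinal lt_i) F_gt0 li_gt0.
  by rewrite /= size_lam /lam; lia.
by split; [exact: (mem_nest_inner n) | exact: inner_matchingP].
Qed.

End MatchingDeterminant.

Theorem theorem6p5 (n : nat) (pi : seq (nat * nat)) :
  is_matching n pi ->
  (forall p : int, 0 <= p ->
     Dpi n pi p = (#|strict_fillings (yshape n pi) (absz p + n)|)%:Z
     /\ 0 < Dpi n pi p)
  /\ (forall p : int, p <= - (n%:Z) ->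
     (-1) ^+ (dpi n pi) * Dpi n pi p
        = (#|weak_fillings (yshape n pi) (absz p - n)%N|)%:Z
     /\ Dpi n pi p != 0)
  /\ Dpi n pi (- (n%:Z)) = (-1) ^+ (dpi n pi)
  /\ (forall p : int, 1 - n%:Z <= p -> p <= -1 ->
     ~ (exists rho : seq (nat * nat),
          (exists m : nat, is_matching m rho) /\ pi =i nest (absz p) rho) ->
     Dpi n pi p = 0).
Proof.
move=> m_matching; split; [|split; [|split]].
- case=> [p _|//]; rewrite absz_nat.
  case: n m_matching => [|n'] m_matching.
    by rewrite /Dpi det_mx00 card_strict_fillings_nil.
  (* The largest admissible entry is k = p + n - 1; [strict_fillings] takes k + 1, the size of the
     ordinal type of the entries. *)
  have -> : Posz p = 1 - n'.+1%:Z + (p + n')%N%:Z by lia.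
  rewrite Dpi_strict_fillings // addnS; split=> //.
  by rewrite ltz_nat card_strict_yshape_gt0 //; lia.
- move=> p le_pn; have D_weak := Dpi_weak_fillings _ _ m_matching (absz p - n).
  have eq_p : - n%:Z - (absz p - n)%N%:Z = p by lia.
  rewrite eq_p in D_weak; split=> //.
  apply/negP => /eqP D0; move: D_weak; rewrite D0 mulr0 => /esym/eqP.
  by rewrite eqz_nat -leqn0 leqNgt card_weak_fillings_gt0.
- have := Dpi_weak_fillings _ _ m_matching 0.
  rewrite card_weak_fillings0 subr0 => D1.
  by rewrite -[LHS](signrMK (dpi n pi)) D1 mulr1.
(* Here p is [Negz q], that is -(q+1), so there are [q.+1] outer arches. *)
- case=> [//|q] le_np _ not_nested; apply/eqP/negP => /negP D0.
  have lt_qn : (q.+1 < n)%N by lia.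
  have [nested inner] := Dpi_neq0_nested _ _ m_matching _ lt_qn D0.
  apply: not_nested; exists (inner_matching pi q.+1); split=> //.
  by exists (n - q.+1)%N.
Qed.
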